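(* $$\frac{315\pi}{16\sqrt{2}} = \sum_{k=0}^{\infty}\left(-\frac1{27}\right)^{k}\frac{\left(\frac18\right)_k\left(\frac14\right)_k\left(\frac58\right)_k(1)_k}{\left(\frac{13}{12}\right)_k\left(\frac{11}{8}\right)_k\left(\frac{17}{12}\right)_k\left(\frac{15}{8}\right)_k}\,\left(448k^3+688k^2+305k+44\right).$$
   Context: For $k\in\mathbb{N}_0$, $(\alpha)_k=\alpha(\alpha+1)\cdots(\alpha+k-1)$ is the rising factorial (Pochhammer symbol), with $(\alpha)_0=1$. *)

(* Defs.v *)
From Stdlib Require Import Reals.
Open Scope R_scope.

(* (a)_k = a (a + 1) ... (a + k - 1) *)
Fixpoint rising (a : R) (k : nat) : R :=
  match k with
  | O => 1
  | S j => rising a j * (a + INR j)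
  end.

(* Main.v *)
Require Import Defs.
From Stdlib Require Import Reals.
From Coquelicot Require Import Coquelicot.
From Stdlib Require Import Lra Lia.
Open Scope R_scope.

(** The terms [wz_F], [wz_G] form a WZ pair:
    [F(n+1,k) - F(n,k) = G(n,k+1) - G(n,k)], obtained from the well-poised
    summand [(-1)^k (a+2k) (b)_k (c)_k (d)_k / ((1+a-b)_k (1+a-c)_k (1+a-d)_k)]
    with [b = 3/4] fixed and [a = 1 + 3n], [c = 1 + n], [d = 1/4 + n],
    times a factor depending on [n] only.
    The columns [G(n,0)] are the terms of the series up to the factor [105/2],
    while [F(0,k) = (3/4) (-1)^k (1/(4k+1) + 1/(4k+3))].  The row sums
    [sum_k F(n,k)] are alternating with decreasing terms, hence bounded by
    [F(n,0) = O(2^-n)], and [G(n,k) -> 0] as [k -> oo]; therefore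
    [sum_n G(n,0) = sum_k F(0,k)], which is [3/4] of the integral over [[0,1]]
    of [(1+x^2)/(1+x^4)]. *)

(* In the rational estimates below, the difference of the two sides expands to a
   polynomial with nonnegative coefficients; this tactic closes such goals. *)
Ltac nonneg :=
  repeat first [ assumption | apply pos_INR | apply Rplus_le_le_0_compat
               | apply Rmult_le_pos
               | apply Rdiv_le_0_compat | apply pow_le | lra ].

(** * The WZ pair and its ratio identities *)

Lemma rising_pos (a : R) (k : nat) : 0 < a -> 0 < rising a k.
Proof.
  intros Ha; induction k as [|k IH]; simpl; [lra|].
  apply Rmult_lt_0_compat; [exact IH | pose proof (pos_INR k); lra].
Qed.

(** A shifted symbol [(alpha + m)_k] is encoded as [rising alpha (k + m)], which differs from it by
    the factor [(alpha)_m], free of [k]. A step in [n] or in [k] then just unrolls [rising] finitely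
    often. *)
Definition wz_base (n k : nat) : R :=
  rising (3/4) n * rising (1/4) (2 * n) * rising 1 (2 * n)
  * (rising (3/4) k * rising 1 (k + n) * rising (1/4) (k + n))
  / (rising (5/4) (k + 3 * n) * rising 1 (k + 2 * n) * rising (7/4) (k + 2 * n)).

(* Found by solving the linear system that [wz_pair] imposes on the coefficients
   of a polynomial of degree 5 in [y = k]. *)
Definition wz_poly (x y : R) : R :=
  (112*x^5 + 312*x^4 + 1333/4*x^3 + 2733/16*x^2 + 1355/32*x + 33/8)
  + (248*x^4 + 547*x^3 + 1737/4*x^2 + 2347/16*x + 1139/64) * y
  + (204*x^3 + 1325/4*x^2 + 171*x + 1783/64) * y^2
  + (77*x^2 + 163/2*x + 327/16) * y^3
  + (14*x + 29/4) * y^4 + y^5.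

(** Chosen so that [wz_den] at [k + 1] times the denominator in [wz_base_succ_r] is exactly the
    denominator in [wz_base_succ_l]. *)
Definition wz_den (x y : R) : R :=
  (5/4 + y + 3*x) * (9/4 + y + 3*x) * (1 + y + 2*x) * (7/4 + y + 2*x).

Definition wz_F (n k : nat) : R :=
  (-1) ^ n * (-1) ^ k * (wz_base n k * (1 + 3 * INR n + 2 * INR k)).

Definition wz_G (n k : nat) : R :=
  (-1) ^ n * (-1) ^ k
  * (wz_base n k * (wz_poly (INR n) (INR k) / wz_den (INR n) (INR k))).

Lemma wz_base_pos (n k : nat) : 0 < wz_base n k.
Proof.
  unfold wz_base, Rdiv.
  repeat first [ apply Rmult_lt_0_compat | apply Rinv_0_lt_compat
               | apply rising_pos; lra ].
Qed.

Lemma wz_den_pos (x y : R) : 0 <= x -> 0 <= y -> 0 < wz_den x y.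
Proof.
  intros; unfold wz_den; repeat apply Rmult_lt_0_compat; lra.
Qed.

Lemma wz_base_succ_r (n k : nat) :
  wz_base n (S k) =
  wz_base n k * ((3/4 + INR k) * (1 + INR k + INR n) * (1/4 + INR k + INR n)
    / ((5/4 + INR k + 3 * INR n) * (1 + INR k + 2 * INR n)
       * (7/4 + INR k + 2 * INR n))).
Proof.
  unfold wz_base.
  rewrite !Nat.add_succ_l; cbn [rising].
  rewrite !plus_INR, !mult_INR, (INR_IZR_INZ 2), (INR_IZR_INZ 3).
  cbn [Z.of_nat Pos.of_succ_nat Pos.succ].
  pose proof (pos_INR n) as Hn; pose proof (pos_INR k) as Hk.
  assert (Hp := fun a m (h : 0 < a) => Rgt_not_eq _ _ (rising_pos a m h)).
  field; repeat split; try lra; apply Hp; lra.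
Qed.

Lemma wz_base_succ_l (n k : nat) :
  wz_base (S n) k =
  wz_base n k * ((3/4 + INR n) * (1/4 + 2 * INR n) * (5/4 + 2 * INR n)
    * (1 + 2 * INR n) * (2 + 2 * INR n)
    * (1 + INR k + INR n) * (1/4 + INR k + INR n)
    / ((5/4 + INR k + 3 * INR n) * (9/4 + INR k + 3 * INR n)
       * (13/4 + INR k + 3 * INR n) * (1 + INR k + 2 * INR n)
       * (2 + INR k + 2 * INR n) * (7/4 + INR k + 2 * INR n)
       * (11/4 + INR k + 2 * INR n))).
Proof.
  unfold wz_base.
  replace (2 * S n)%nat with (S (S (2 * n))) by lia.
  replace (3 * S n)%nat with (S (S (S (3 * n)))) by lia.
  rewrite !Nat.add_succ_r; cbn [rising].
  rewrite !S_INR, !plus_INR, !mult_INR, (INR_IZR_INZ 2), (INR_IZR_INZ 3).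
  cbn [Z.of_nat Pos.of_succ_nat Pos.succ].
  pose proof (pos_INR n) as Hn; pose proof (pos_INR k) as Hk.
  assert (Hp := fun a m (h : 0 < a) => Rgt_not_eq _ _ (rising_pos a m h)).
  field; repeat split; try lra; apply Hp; lra.
Qed.

(** Both ratio lemmas make every term a multiple of [wz_base n k]; what remains is an identity of
    rational functions in [n] and [k]. *)
Lemma wz_pair (n k : nat) :
  wz_F (S n) k - wz_F n k = wz_G n (S k) - wz_G n k.
Proof.
  unfold wz_F, wz_G, wz_den, wz_poly.
  rewrite wz_base_succ_l, wz_base_succ_r, !S_INR; cbn [pow].
  pose proof (pos_INR n) as Hn; pose proof (pos_INR k) as Hk.
  field; repeat split; lra.
Qed.

(** * Decay estimates in both directions *)

(** The ratio in [k] is at most [((1 + k) / (2 + k))^2]. Quadratic decay is enough to beat the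
    linear growth in [wz_quotient_bound]. *)
Lemma wz_base_decay (n k : nat) :
  wz_base n k * (1 + INR k) ^ 2 <= wz_base n 0.
Proof.
  induction k as [|k IH]; [simpl; lra|].
  refine (Rle_trans _ _ _ _ IH).
  rewrite wz_base_succ_r, S_INR.
  pose proof (pos_INR n) as Hn; pose proof (pos_INR k) as Hk.
  rewrite Rmult_assoc.
  apply Rmult_le_compat_l; [apply Rlt_le, wz_base_pos|].
  unfold Rdiv; rewrite Rmult_assoc, (Rmult_comm (/ _)), <- Rmult_assoc.
  apply Rle_div_l; [repeat apply Rmult_lt_0_compat; lra|].
  revert Hn Hk; generalize (INR n) (INR k); intros x y Hx Hy.
  apply Rminus_le_0; field_simplify; nonneg.
Qed.

Lemma wz_F_abs_decreasing (n k : nat) :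
  wz_base n (S k) * (1 + 3 * INR n + 2 * INR (S k))
  <= wz_base n k * (1 + 3 * INR n + 2 * INR k).
Proof.
  rewrite wz_base_succ_r, S_INR.
  pose proof (pos_INR n) as Hn; pose proof (pos_INR k) as Hk.
  rewrite Rmult_assoc.
  apply Rmult_le_compat_l; [apply Rlt_le, wz_base_pos|].
  unfold Rdiv; rewrite Rmult_assoc, (Rmult_comm (/ _)), <- Rmult_assoc.
  apply Rle_div_l; [repeat apply Rmult_lt_0_compat; lra|].
  revert Hn Hk; generalize (INR n) (INR k); intros x y Hx Hy.
  apply Rminus_le_0; field_simplify; nonneg.
Qed.

(** Successive heads have a ratio tending to 1/27; the crude bound 1/2 holds from [n = 0] on, where
    the head equals 1. *)
Lemma wz_F_head_geometric (n : nat) :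
  wz_base n 0 * (1 + 3 * INR n) <= (1/2) ^ n.
Proof.
  induction n as [|n IH]; [unfold wz_base; simpl; lra|].
  apply Rle_trans with (1/2 * (wz_base n 0 * (1 + 3 * INR n)));
    [|cbn [pow]; apply Rmult_le_compat_l; [lra | exact IH]].
  rewrite wz_base_succ_l, S_INR; cbn [INR].
  pose proof (pos_INR n) as Hn.
  rewrite <- Rmult_assoc, (Rmult_comm (1/2)), !Rmult_assoc.
  apply Rmult_le_compat_l; [apply Rlt_le, wz_base_pos|].
  unfold Rdiv; rewrite <- !Rmult_assoc.
  rewrite (Rmult_comm _ (1 + 3 * (INR n + 1))), <- !Rmult_assoc.
  apply Rle_div_l; [repeat apply Rmult_lt_0_compat; lra|].
  revert Hn; generalize (INR n); intros x Hx.
  apply Rminus_le_0; field_simplify; nonneg.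
Qed.

(** [wz_poly x 1] is the sum of the [y]-coefficients of [wz_poly x y], and every [y]-coefficient of
    [(1 + y) * wz_den x y] is at least 1, so the upper bound holds coefficientwise. *)
Lemma wz_quotient_bound (x y : R) : 0 <= x -> 0 <= y ->
  0 <= wz_poly x y / wz_den x y <= wz_poly x 1 * (1 + y).
Proof.
  intros Hx Hy; pose proof (wz_den_pos x y Hx Hy) as Hd; split.
  - apply Rdiv_le_0_compat; [unfold wz_poly; nonneg | exact Hd].
  - apply Rle_div_l; [exact Hd|].
    unfold wz_poly, wz_den.
    apply Rminus_le_0; field_simplify; nonneg.
Qed.

Lemma is_lim_seq_inv_INR_S : is_lim_seq (fun k => / INR (S k)) 0.
Proof.
  apply (is_lim_seq_incr_1 (fun k => / INR k)).
  replace (Finite 0) with (Rbar_inv p_infty) by reflexivity.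
  apply is_lim_seq_inv; [apply is_lim_seq_INR | discriminate].
Qed.

Lemma wz_G_lim (n : nat) : is_lim_seq (wz_G n) 0.
Proof.
  apply is_lim_seq_abs_0.
  apply is_lim_seq_le_le with (fun _ => 0)
    (fun k => wz_base n 0 * wz_poly (INR n) 1 * / INR (S k)).
  - intro k; split; [apply Rabs_pos|].
    unfold wz_G; rewrite !Rabs_mult, !pow_1_abs, !Rmult_1_l.
    pose proof (pos_INR n) as Hn; pose proof (pos_INR k) as Hk.
    destruct (wz_quotient_bound _ _ Hn Hk) as [H0 H1].
    pose proof (wz_base_pos n k) as Hb.
    rewrite (Rabs_pos_eq _ H0), (Rabs_pos_eq _ (Rlt_le _ _ Hb)).
    apply (Rle_div_r _ _ (INR (S k))); [apply lt_0_INR; lia|].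
    rewrite S_INR.
    apply Rle_trans with (wz_base n k * (1 + INR k) ^ 2 * wz_poly (INR n) 1).
    + replace (wz_base n k * (1 + INR k) ^ 2 * wz_poly (INR n) 1)
        with (wz_base n k * (wz_poly (INR n) 1 * (1 + INR k)) * (INR k + 1)) by ring.
      apply Rmult_le_compat_r; [lra|].
      apply Rmult_le_compat_l; lra.
    + apply Rmult_le_compat_r; [unfold wz_poly; nonneg | apply wz_base_decay].
  - apply is_lim_seq_const.
  - replace (Finite 0) with (Rbar_mult (wz_base n 0 * wz_poly (INR n) 1) 0)
      by (simpl; f_equal; ring).
    apply is_lim_seq_scal_l, is_lim_seq_inv_INR_S.
Qed.

(** * Row sums and their transfer to the column *)

(** The sum is [a 0] minus the alternating sum of the shifted sequence; quantifying over [a] after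
    [K] lets the induction hypothesis apply to that shift. *)
Lemma alternating_sum_bounds (K : nat) : forall a : nat -> R,
  (forall k, 0 <= a k) -> (forall k, a (S k) <= a k) ->
  0 <= sum_f_R0 (fun k => (-1) ^ k * a k) K <= a O.
Proof.
  induction K as [|K IH]; intros a Ha Hd; [simpl; specialize (Ha O); lra|].
  rewrite decomp_sum by lia; cbn [Nat.pred pow].
  specialize (IH (fun k => a (S k)) (fun k => Ha (S k)) (fun k => Hd (S k))).
  cbv beta in IH.
  rewrite (sum_eq _ (fun k => (-1) ^ k * a (S k) * (-1)))
    by (intros; ring).
  rewrite <- scal_sum.
  specialize (Hd O); lra.
Qed.

Lemma wz_F_sum_bound (n K : nat) :
  Rabs (sum_f_R0 (wz_F n) K) <= (1/2) ^ n.
Proof.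
  rewrite (sum_eq _ (fun k => (-1) ^ k
    * (wz_base n k * (1 + 3 * INR n + 2 * INR k)) * (-1) ^ n))
    by (intros; unfold wz_F; ring).
  rewrite <- scal_sum, Rabs_mult, pow_1_abs, Rmult_1_l.
  assert (H : 0 <= sum_f_R0 (fun k => (-1) ^ k
      * (wz_base n k * (1 + 3 * INR n + 2 * INR k))) K
    <= wz_base n 0 * (1 + 3 * INR n + 2 * INR 0)).
  { apply (alternating_sum_bounds K
      (fun k => wz_base n k * (1 + 3 * INR n + 2 * INR k))); intro k.
    - apply Rmult_le_pos; [apply Rlt_le, wz_base_pos | nonneg].
    - apply wz_F_abs_decreasing. }
  rewrite Rabs_pos_eq by apply H.
  refine (Rle_trans _ _ _ (proj2 H) _).
  cbn [INR]; rewrite Rmult_0_r, Rplus_0_r; apply wz_F_head_geometric.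
Qed.

Lemma wz_F_sum_succ (n K : nat) :
  sum_f_R0 (wz_F (S n)) K
  = sum_f_R0 (wz_F n) K + (wz_G n (S K) - wz_G n 0).
Proof.
  induction K as [|K IH]; cbn [sum_f_R0].
  - pose proof (wz_pair n 0); lra.
  - pose proof (wz_pair n (S K)); lra.
Qed.

(** Telescoping in [k] changes the row sum by [wz_G n (S K) - wz_G n 0], and the first term vanishes
    in the limit. *)
Lemma wz_F_row_lim (l : R) :
  is_lim_seq (sum_f_R0 (wz_F 0)) l -> forall n,
  is_lim_seq (sum_f_R0 (wz_F (S n))) (l - sum_f_R0 (fun i => wz_G i 0) n).
Proof.
  intro Hl.
  assert (step : forall n (l' : R), is_lim_seq (sum_f_R0 (wz_F n)) l' ->
            is_lim_seq (sum_f_R0 (wz_F (S n))) (l' - wz_G n 0)).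
  { intros n l' H.
    eapply is_lim_seq_ext; [intro K; symmetry; apply wz_F_sum_succ|].
    replace (l' - wz_G n 0) with (l' + (0 - wz_G n 0)) by ring.
    apply is_lim_seq_plus'; [exact H|].
    apply is_lim_seq_minus'; [|apply is_lim_seq_const].
    apply -> is_lim_seq_incr_1; apply wz_G_lim. }
  induction n as [|n IH]; cbn [sum_f_R0].
  - apply step, Hl.
  - replace (l - _) with (l - sum_f_R0 (fun i => wz_G i 0) n - wz_G (S n) 0) by ring.
    apply step, IH.
Qed.

Lemma wz_transfer (l : R) :
  is_lim_seq (sum_f_R0 (wz_F 0)) l ->
  is_lim_seq (sum_f_R0 (fun n => wz_G n 0)) l.
Proof.
  intro Hl.
  assert (Hg : is_lim_seq (fun n => (1/2) ^ (S n)) 0).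
  { apply (is_lim_seq_incr_1 (fun n => (1/2) ^ n)).
    apply is_lim_seq_geom; rewrite Rabs_pos_eq; lra. }
  apply is_lim_seq_le_le with
    (fun n => l - (1/2) ^ (S n)) (fun n => l + (1/2) ^ (S n)).
  - intro n.
    (* The left side is the limit of row [S n]; the bound on its partial sums is uniform in [K], so
       it survives the limit. *)
    assert (H : Rbar_le (Rabs (l - sum_f_R0 (fun i => wz_G i 0) n)) ((1/2) ^ (S n))).
    { eapply is_lim_seq_le;
        [ intro K; apply (wz_F_sum_bound (S n) K)
        | apply (is_lim_seq_abs _ (Finite _)), wz_F_row_lim, Hl
        | apply is_lim_seq_const ]. }
    apply Rabs_le_between in H; lra.
  - replace (Finite l) with (Finite (l - 0)) by (f_equal; ring).
    apply is_lim_seq_minus'; [apply is_lim_seq_const | exact Hg].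
  - replace (Finite l) with (Finite (l + 0)) by (f_equal; ring).
    apply is_lim_seq_plus'; [apply is_lim_seq_const | exact Hg].
Qed.

(** * Row zero and the integral of [(1 + x^2) / (1 + x^4)] *)

(** Here [(1/4)_k / (5/4)_k] collapses to [1 / (4k + 1)] and [(3/4)_k / (7/4)_k] to [3 / (4k + 3)];
    the weight [1 + 2k] gives the partial fractions. *)
Lemma wz_F_0 (k : nat) :
  wz_F 0 k = (-1) ^ k * (1 / (4 * INR k + 1) + 1 / (4 * INR k + 3)) * (3/4).
Proof.
  assert (H : wz_base 0 k = 3 / ((4 * INR k + 1) * (4 * INR k + 3))).
  { induction k as [|k IH]; [unfold wz_base; simpl; lra|].
    rewrite wz_base_succ_r, IH, S_INR; cbn [INR].
    pose proof (pos_INR k); field; repeat split; lra. }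
  unfold wz_F; rewrite H; cbn [INR pow].
  pose proof (pos_INR k); field; lra.
Qed.

Lemma is_derive_pow_div (m : nat) (x : R) :
  is_derive (fun t => t ^ S m / INR (S m)) x (x ^ m).
Proof.
  assert (H : INR (S m) <> 0) by (apply not_0_INR; lia).
  auto_derive; [exact I|].
  cbn [Nat.pred]; field; exact H.
Qed.

(** The primitive, zero at 0, of the truncated geometric expansion of [(1 + x^2) / (1 + x^4)] in
    powers of [- x^4]. *)
Definition quartic_sum (K : nat) (x : R) : R :=
  sum_f_R0 (fun k => (-1) ^ k
    * (x ^ S (4 * k) / INR (S (4 * k)) + x ^ S (4 * k + 2) / INR (S (4 * k + 2)))) K.

Lemma is_derive_quartic_sum (K : nat) (x : R) :
  is_derive (quartic_sum K) x
    ((1 + x ^ 2) * (1 - (- x ^ 4) ^ S K) / (1 + x ^ 4)).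
Proof.
  assert (Hx : 0 < 1 + x ^ 4) by (replace (x ^ 4) with ((x ^ 2) ^ 2) by ring; nra).
  assert (term : forall k, is_derive (fun t => (-1) ^ k
    * (t ^ S (4 * k) / INR (S (4 * k)) + t ^ S (4 * k + 2) / INR (S (4 * k + 2)))) x
    ((-1) ^ k * (x ^ (4 * k) + x ^ (4 * k + 2)))).
  { intro k.
    apply (is_derive_scal (fun t => t ^ S (4 * k) / INR (S (4 * k))
                                  + t ^ S (4 * k + 2) / INR (S (4 * k + 2)))).
    apply (is_derive_plus (fun t => t ^ S (4 * k) / INR (S (4 * k)))
             (fun t => t ^ S (4 * k + 2) / INR (S (4 * k + 2))));
      apply is_derive_pow_div. }
  assert (alg : forall k, (-1) ^ k * (x ^ (4 * k) + x ^ (4 * k + 2))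
                          = (- x ^ 4) ^ k * (1 + x ^ 2)).
  { intro k; rewrite pow_add, pow_mult.
    replace (- x ^ 4) with (-1 * x ^ 4) by ring.
    rewrite Rpow_mult_distr; ring. }
  induction K as [|K IH].
  - replace ((1 + x ^ 2) * (1 - (- x ^ 4) ^ 1) / (1 + x ^ 4))
      with ((-1) ^ 0 * (x ^ (4 * 0) + x ^ (4 * 0 + 2)));
      [exact (term O)|].
    rewrite alg, pow_O, pow_1; field; lra.
  - apply (is_derive_ext (fun t => quartic_sum K t + (-1) ^ S K
      * (t ^ S (4 * S K) / INR (S (4 * S K))
         + t ^ S (4 * S K + 2) / INR (S (4 * S K + 2)))));
      [reflexivity|].
    replace ((1 + x ^ 2) * (1 - (- x ^ 4) ^ S (S K)) / (1 + x ^ 4))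
      with ((1 + x ^ 2) * (1 - (- x ^ 4) ^ S K) / (1 + x ^ 4)
            + (-1) ^ S K * (x ^ (4 * S K) + x ^ (4 * S K + 2))).
    + exact (is_derive_plus _ _ _ _ _ IH (term (S K))).
    + rewrite alg, <- (tech_pow_Rmult _ (S K)); field; lra.
Qed.

(** Obtained from [1 + x^4 = (x^2 + sqrt 2 x + 1) (x^2 - sqrt 2 x + 1)] by partial fractions. *)
Definition quartic_primitive (x : R) : R :=
  / sqrt 2 * (atan (sqrt 2 * x + 1) + atan (sqrt 2 * x - 1)).

Lemma is_derive_quartic_primitive (x : R) :
  is_derive quartic_primitive x ((1 + x ^ 2) / (1 + x ^ 4)).
Proof.
  unfold quartic_primitive.
  assert (H2 : sqrt 2 * sqrt 2 = 2) by (apply sqrt_sqrt; lra).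
  assert (H0 : 0 < sqrt 2) by (apply sqrt_lt_R0; lra).
  assert (Hx : 0 < 1 + x ^ 4) by (replace (x ^ 4) with ((x ^ 2) ^ 2) by ring; nra).
  auto_derive; [exact I|].
  set (s := sqrt 2) in *.
  assert (Hp : 0 < 1 + (s * x + 1) ^ 2) by nra.
  assert (Hm : 0 < 1 + (s * x - 1) ^ 2) by nra.
  (* [(1 + (s x + 1)^2) (1 + (s x - 1)^2) = 4 (1 + x^4)] when [s^2 = 2] *)
  assert (Hf : (1 + (s * x + 1) ^ 2) * (1 + (s * x - 1) ^ 2) = 4 * (1 + x ^ 4)).
  { replace ((1 + (s * x + 1) ^ 2) * (1 + (s * x - 1) ^ 2))
      with ((s * s) ^ 2 * x ^ 4 + 4) by ring.
    rewrite H2; ring. }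
  transitivity (((1 + (s * x + 1) ^ 2) + (1 + (s * x - 1) ^ 2))
                / ((1 + (s * x + 1) ^ 2) * (1 + (s * x - 1) ^ 2))).
  - field; repeat split; lra.
  - rewrite Hf.
    replace (1 + (s * x + 1) ^ 2 + (1 + (s * x - 1) ^ 2))
      with (2 * (s * s) * x ^ 2 + 4) by ring.
    rewrite H2; field; lra.
Qed.

Lemma quartic_primitive_0 : quartic_primitive 0 = 0.
Proof.
  unfold quartic_primitive.
  replace (sqrt 2 * 0 - 1) with (- (sqrt 2 * 0 + 1)) by ring.
  rewrite atan_opp; ring.
Qed.

Lemma quartic_primitive_1 : quartic_primitive 1 = PI / (2 * sqrt 2).
Proof.
  unfold quartic_primitive.
  assert (H2 : sqrt 2 * sqrt 2 = 2) by (apply sqrt_sqrt; lra).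
  assert (H0 : 0 < sqrt 2) by (apply sqrt_lt_R0; lra).
  (* The two arguments are reciprocal, so their arctangents add up to [PI / 2]. *)
  replace (sqrt 2 * 1 - 1) with (/ (sqrt 2 * 1 + 1)).
  - rewrite atan_inv by lra; field; lra.
  - apply Rmult_eq_reg_l with (sqrt 2 * 1 + 1); [|lra].
    rewrite Rinv_r by lra; lra.
Qed.

Lemma quartic_sum_0 (K : nat) : quartic_sum K 0 = 0.
Proof.
  unfold quartic_sum; rewrite (sum_eq _ (fun _ => 0)).
  - rewrite sum_cte; ring.
  - intros k _; cbn [pow]; rewrite !Rmult_0_l; unfold Rdiv; ring.
Qed.

Lemma nonneg_of_derive_nonneg (f df : R -> R) (b : R) :
  0 <= b -> f 0 = 0 -> (forall x, is_derive f x (df x)) ->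
  (forall x, 0 <= x -> 0 <= df x) -> 0 <= f b.
Proof.
  intros Hb Hf0 Hf Hdf.
  destruct (MVT_gen f 0 b df) as [c [Hc E]].
  - intros x _; apply Hf.
  - intros x _; apply continuity_pt_filterlim, (ex_derive_continuous f).
    eexists; apply Hf.
  - rewrite Rmin_left, Rmax_right in Hc by lra.
    specialize (Hdf c (proj1 Hc)).
    rewrite Hf0, !Rminus_0_r in E; rewrite E; apply Rmult_le_pos; lra.
Qed.

(** The derivative of the difference is the geometric remainder, at most [2 * x^(4(K+1))] in
    absolute value because [1 + x^2 <= 2 (1 + x^4)]; the bound is the primitive of this at 1. *)
Lemma quartic_sum_error (K : nat) :
  Rabs (quartic_sum K 1 - quartic_primitive 1) <= 2 / INR (S (4 * S K)).
Proof.
  assert (bound : forall x, Rabs ((1 + x ^ 2) / (1 + x ^ 4) * (- x ^ 4) ^ S K)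
                            <= 2 * x ^ (4 * S K)).
  { intro x.
    assert (Hq : 0 <= x ^ 4) by (replace (x ^ 4) with ((x ^ 2) ^ 2) by ring; nra).
    rewrite Rabs_mult, <- RPow_abs, Rabs_Ropp, (Rabs_pos_eq _ Hq), <- pow_mult.
    assert (0 <= x ^ (4 * S K)) by (rewrite pow_mult; apply pow_le, Hq).
    apply Rmult_le_compat_r; [assumption|].
    rewrite Rabs_pos_eq by (apply Rdiv_le_0_compat; nra).
    apply Rle_div_l; [lra|].
    replace (x ^ 4) with ((x ^ 2) ^ 2) by ring; nra. }
  (* The sign [e] splits the absolute value into two inequalities, each a function with nonnegative
     derivative. *)
  assert (side : forall e, e = 1 \/ e = -1 ->
    0 <= 2 * (1 ^ S (4 * S K) / INR (S (4 * S K)))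
         + e * (quartic_sum K 1 - quartic_primitive 1)).
  { intros e He.
    apply (nonneg_of_derive_nonneg
      (fun x => 2 * (x ^ S (4 * S K) / INR (S (4 * S K)))
                + e * (quartic_sum K x - quartic_primitive x))
      (fun x => 2 * x ^ (4 * S K)
         + e * ((1 + x ^ 2) * (1 - (- x ^ 4) ^ S K) / (1 + x ^ 4)
                - (1 + x ^ 2) / (1 + x ^ 4)))); [lra| | |].
    - rewrite quartic_sum_0, quartic_primitive_0, pow_i by lia.
      unfold Rdiv; ring.
    - intro x.
      apply (is_derive_plus (fun t => 2 * (t ^ S (4 * S K) / INR (S (4 * S K))))
               (fun t => e * (quartic_sum K t - quartic_primitive t))).
      + apply (is_derive_scal (fun t => t ^ S (4 * S K) / INR (S (4 * S K)))).
        apply is_derive_pow_div.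
      + apply (is_derive_scal (fun t => quartic_sum K t - quartic_primitive t)).
        apply (is_derive_minus (quartic_sum K) quartic_primitive).
        * apply is_derive_quartic_sum.
        * apply is_derive_quartic_primitive.
    - intros x _.
      assert (Hx : 0 < 1 + x ^ 4)
        by (replace (x ^ 4) with ((x ^ 2) ^ 2) by ring; nra).
      replace ((1 + x ^ 2) * (1 - (- x ^ 4) ^ S K) / (1 + x ^ 4)
                - (1 + x ^ 2) / (1 + x ^ 4))
        with (- ((1 + x ^ 2) / (1 + x ^ 4) * (- x ^ 4) ^ S K)) by (field; lra).
      pose proof (proj1 (Rabs_le_between _ _) (bound x)).
      destruct He; subst e; lra. }
  pose proof (side 1 (or_introl eq_refl)); pose proof (side (-1) (or_intror eq_refl)).
  rewrite pow1 in *.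
  apply Rabs_le_between; unfold Rdiv in *; lra.
Qed.

Lemma quartic_series :
  is_lim_seq (fun K => quartic_sum K 1) (PI / (2 * sqrt 2)).
Proof.
  rewrite <- quartic_primitive_1.
  assert (Hl : is_lim_seq (fun K => 2 / INR (S (4 * S K))) 0).
  { apply is_lim_seq_le_le with (fun _ => 0) (fun K => 2 * / INR (S K)).
    - intro K; split; [apply Rdiv_le_0_compat; [lra | apply lt_0_INR; lia]|].
      apply Rmult_le_compat_l; [lra|].
      apply Rinv_le_contravar; [apply lt_0_INR; lia | apply le_INR; lia].
    - apply is_lim_seq_const.
    - replace (Finite 0) with (Rbar_mult 2 0) by (simpl; f_equal; ring).
      apply is_lim_seq_scal_l, is_lim_seq_inv_INR_S. }
  apply is_lim_seq_le_le with
    (fun K => quartic_primitive 1 - 2 / INR (S (4 * S K)))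
    (fun K => quartic_primitive 1 + 2 / INR (S (4 * S K))).
  - intro K; pose proof (proj1 (Rabs_le_between _ _) (quartic_sum_error K)); lra.
  - replace (Finite (quartic_primitive 1)) with (Finite (quartic_primitive 1 - 0))
      by (f_equal; ring).
    apply is_lim_seq_minus'; [apply is_lim_seq_const | exact Hl].
  - replace (Finite (quartic_primitive 1)) with (Finite (quartic_primitive 1 + 0))
      by (f_equal; ring).
    apply is_lim_seq_plus'; [apply is_lim_seq_const | exact Hl].
Qed.

(** * Identification of the series and conclusion *)

Lemma wz_F_0_series :
  is_lim_seq (sum_f_R0 (wz_F 0)) (3/4 * (PI / (2 * sqrt 2))).
Proof.
  eapply is_lim_seq_ext; [|exact (is_lim_seq_scal_l _ (3/4) _ quartic_series)].
  intro K; cbv beta; unfold quartic_sum; rewrite scal_sum.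
  apply sum_eq; intros k _.
  rewrite wz_F_0, !pow1, !S_INR, plus_INR, mult_INR.
  replace (INR 4) with 4 by (simpl; ring); replace (INR 2) with 2 by (simpl; ring).
  replace (4 * INR k + 2 + 1) with (4 * INR k + 3) by ring; reflexivity.
Qed.

(** [wz_poly n 0] factors as [(n + 3/4) (2n + 1) / 8] times the cubic of the series. *)
Lemma wz_G_0 (n : nat) :
  105/2 * wz_G n 0 =
  (- (1 / 27)) ^ n
  * ((rising (1 / 8) n * rising (1 / 4) n * rising (5 / 8) n * rising 1 n)
     / (rising (13 / 12) n * rising (11 / 8) n
        * rising (17 / 12) n * rising (15 / 8) n))
  * (448 * INR n ^ 3 + 688 * INR n ^ 2 + 305 * INR n + 44).
Proof.
  assert (Hp := fun a m (h : 0 < a) => Rgt_not_eq _ _ (rising_pos a m h)).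
  (* The rest is matched by comparing ratios in [n]; [105/16] makes the right side 1 at [n = 0]. *)
  assert (H : (1 / 27) ^ n
    * ((rising (1 / 8) n * rising (1 / 4) n * rising (5 / 8) n * rising 1 n)
       / (rising (13 / 12) n * rising (11 / 8) n
          * rising (17 / 12) n * rising (15 / 8) n))
    = 105/16 * wz_base n 0 * ((INR n + 3/4) * (2 * INR n + 1))
      / wz_den (INR n) 0).
  { induction n as [|n IH]; [unfold wz_base, wz_den; simpl; field|].
    pose proof (pos_INR n) as Hn.
    transitivity ((1 / 27) ^ n
      * ((rising (1 / 8) n * rising (1 / 4) n * rising (5 / 8) n * rising 1 n)
         / (rising (13 / 12) n * rising (11 / 8) n
            * rising (17 / 12) n * rising (15 / 8) n))
      * (/ 27 * ((1/8 + INR n) * (1/4 + INR n) * (5/8 + INR n) * (1 + INR n)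
         / ((13/12 + INR n) * (11/8 + INR n) * (17/12 + INR n) * (15/8 + INR n))))).
    - cbn [rising pow]; field; repeat split; try lra; apply Hp; lra.
    - rewrite IH, wz_base_succ_l, S_INR; unfold wz_den; cbn [INR].
      field; repeat split; lra. }
  pose proof (pos_INR n) as Hn.
  unfold wz_G; cbn [INR pow].
  replace (- (1 / 27)) with (-1 * (1 / 27)) by ring.
  rewrite Rpow_mult_distr, (Rmult_assoc ((-1) ^ n) ((1 / 27) ^ n)), H.
  unfold wz_poly, wz_den; field; repeat split; lra.
Qed.

Theorem mainTheorem15 :
  is_series
    (fun k : nat =>
       (- (1 / 27)) ^ k
       * ((rising (1 / 8) k * rising (1 / 4) k * rising (5 / 8) k * rising 1 k)
          / (rising (13 / 12) k * rising (11 / 8) k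
             * rising (17 / 12) k * rising (15 / 8) k))
       * (448 * INR k ^ 3 + 688 * INR k ^ 2 + 305 * INR k + 44))
    (315 * PI / (16 * sqrt 2)).
Proof.
  apply is_series_ext with (fun n => 105/2 * wz_G n 0); [exact wz_G_0|].
  replace (315 * PI / (16 * sqrt 2))
    with (105/2 * (3/4 * (PI / (2 * sqrt 2))))
    by (field; apply Rgt_not_eq, sqrt_lt_R0; lra).
  apply (is_series_scal_l (105/2) (fun n => wz_G n 0)).
  apply is_series_Reals, is_lim_seq_Reals, wz_transfer, wz_F_0_series.
Qed.
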